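(* Let $\rho\in(0,\pi]$ and $h>0$. Let $X_1,X_2,\ldots$ be i.i.d. observations in $\mathbb{R}^d$ drawn from a distribution $P_X$ with support $S$. Assume that $S$ is compact and standard with respect to $P_X$, and denote $\aleph_n=\{X_1,\ldots,X_n\}$. (a) If $S\in\mathcal{C}_{\rho,h}$, then $$d_H\big(\mathbb{C}_{\rho,h}(\aleph_n),S\big)=\mathcal{O}\Big(\Big(\frac{\log n}{n}\Big)^{1/d}\Big)\quad\text{a.s.}$$ (b) If $S\in\tilde{\mathcal{C}}_{\rho,h}$, then $$d_H\big(\tilde{\mathbb{C}}_{\rho,h}(\aleph_n),S\big)=\mathcal{O}\Big(\Big(\frac{\log n}{n}\Big)^{1/d}\Big)\quad\text{a.s.}$$
   Context: $B(x,h)$ denotes the open Euclidean ball in $\mathbb{R}^d$ and $\mu$ the Lebesgue measure on $\mathbb{R}^d$. For $x\in\mathbb{R}^d$, a unit vector $\xi$, $\rho\in(0,\pi]$ and $h>0$, the finite open cone is $$C_{\rho,\xi,h}(x)=B(x,h)\cap\Big\{z\in\mathbb{R}^d,\ z\ne x:\ \Big\langle \xi,\frac{z-x}{\|z-x\|}\Big\rangle>\cos(\rho/2)\Big\}.$$ $\mathcal{C}_{\rho,h}$ is the class of nonempty compact sets $S\subset\mathbb{R}^d$ such that for every $x\in\partial S$ there is a unit vector $\xi$ with $C_{\rho,\xi,h}(x)\subset S^c$. $\tilde{\mathcal{C}}_{\rho,h}$ is the class of nonempty compact sets $S\subset\mathbb{R}^d$ such that $S$ equals the intersection of the complements of all cones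 $C_{\rho,\xi,h}(y)$ ($y\in\mathbb{R}^d$, $\|\xi\|=1$) disjoint from $S$. For a bounded set $A\subset\mathbb{R}^d$, $\mathbb{C}_{\rho,h}(A)$ is the intersection of all sets $B\in\mathcal{C}_{\rho,h}$ with $A\subset B$; $\tilde{\mathbb{C}}_{\rho,h}(A)$ is the intersection of the complements of all cones $C_{\rho,\xi,h}(y)$ disjoint from $A$ (equivalently, the intersection of all $B\in\tilde{\mathcal{C}}_{\rho,h}$ with $A\subset B$). A set $S\subset\mathbb{R}^d$ is standard with respect to a Borel measure $\nu$ if there exist $\lambda>0$, $\delta>0$ such that $\nu(B(x,\varepsilon)\cap S)\ge\delta\,\mu(B(x,\varepsilon))$ for all $x\in S$ and $0<\varepsilon\le\lambda$. $d_H$ is the Hausdorff distance between nonempty compact sets. ''$Z_n=\mathcal{O}(a_n)$ a.s.'' means that, with probability one, $\limsup_n |Z_n|/a_n<\infty$. *)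

(* Defs.v *)
From HB Require Import structures.
From mathcomp Require Import all_boot all_order all_algebra finmap.
From mathcomp Require Import all_classical all_reals all_analysis.
From mathcomp Require Import measurable_realfun.

Set Implicit Arguments.
Unset Strict Implicit.
Unset Printing Implicit Defensive.
Import Order.TTheory GRing.Theory Num.Theory.
Import numFieldNormedType.Exports.
Local Open Scope classical_set_scope.
Local Open Scope ring_scope.

(** R^d is ['rV[R]_d]. The library norm on it is the sup norm, which induces the
    usual topology; every metric notion below uses the Euclidean norm [enorm]. *)

Section euclidean.
Context {R : realType} {d : nat}.
Implicit Types (x xi : 'rV[R]_d) (A B S : set 'rV[R]_d) (rho h : R).

Definition dotp (u v : 'rV[R]_d) : R := \sum_i u 0 i * v 0 i.

Definition enorm (u : 'rV[R]_d) : R := Num.sqrt (dotp u u).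

Definition eball x h : set 'rV[R]_d := [set z | enorm (z - x) < h].

Definition cone rho xi h x : set 'rV[R]_d :=
  eball x h `&`
  [set z | z != x /\ cos (rho / 2) < dotp xi ((enorm (z - x))^-1 *: (z - x))].

Definition frontier S : set 'rV[R]_d := closure S `\` interior S.

Definition cone_convex rho h S : Prop :=
  [/\ compact S, S !=set0 &
      forall x, frontier S x ->
        exists2 xi, enorm xi = 1 & cone rho xi h x `<=` ~` S].

Definition cone_hull rho h A : set 'rV[R]_d :=
  \bigcap_(B in [set B | cone_convex rho h B /\ A `<=` B]) B.

Definition cone_hull_compl rho h A : set 'rV[R]_d :=
  \bigcap_(p in [set p : 'rV[R]_d * 'rV[R]_d |
                  enorm p.2 = 1 /\ cone rho p.2 h p.1 `&` A = set0])
    ~` cone rho p.2 h p.1.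

Definition cone_convex_compl rho h S : Prop :=
  [/\ compact S, S !=set0 & S = cone_hull_compl rho h S].

Definition hausdorff_dist A B : \bar R :=
  maxe
    (ereal_sup [set ereal_inf [set (enorm (a - b))%:E | b in B] | a in A])
    (ereal_sup [set ereal_inf [set (enorm (a - b))%:E | a in A] | b in B]).

End euclidean.

Notation borel T := (g_sigma_algebraType (@open T)).

Section lebesgue.
Context {R : realType}.

Definition consrV n (p : R * borel 'rV[R]_n) : borel 'rV[R]_n.+1 :=
  row_mx (p.1%:M : 'rV[R]_1) (p.2 : 'rV[R]_n).

(** The product of [n] copies of the Lebesgue measure on the line, carried to
    ['rV[R]_n] by the identification of R x R^n with R^(n+1). *)
Fixpoint lebesgue_rV n : set (borel 'rV[R]_n) -> \bar R :=
  match n with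
  | 0 => dirac ((0 : 'rV[R]_0) : borel 'rV[R]_0)
  | m.+1 => pushforward (@lebesgue_measure R \x @lebesgue_rV m)%E (@consrV m)
  end.

End lebesgue.

Section lebesgue_theory.
Context {R : realType}.

Lemma consrV0 n (p : R * borel 'rV[R]_n) : consrV p 0 0 = p.1.
Proof.
rewrite /consrV mxE; case: splitP => [j _|j /eqP]//.
by rewrite ord1 mxE eqxx mulr1n.
Qed.

Lemma consrV_lift n (p : R * borel 'rV[R]_n) j :
  consrV p 0 (lift ord0 j) = (p.2 : 'rV[R]_n) 0 j.
Proof.
rewrite /consrV mxE; case: splitP => [[[]//]|k].
by rewrite lift0 add1n => -[/val_inj->].
Qed.

Lemma preimage_consrV_ball n (q : 'rV[R]_n.+1) (r : R) :
  0 < r ->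
  @consrV R n @^-1` ball q r =
  ball (q 0 0) r `*` ball (\row_j q 0 (lift ord0 j) : 'rV[R]_n) r.
Proof.
move=> r0; apply/seteqP; split => -[x v].
  move=> [_ H]; split => /=.
    by have := H 0 0; rewrite consrV0.
  by split => // i j; rewrite ord1 mxE; have := H 0 (lift ord0 j); rewrite consrV_lift.
move=> [/= H0 [_ H1]]; split => // i j; rewrite ord1.
have [j' ->|->] := unliftP ord0 j; last by rewrite consrV0.
by have := H1 0 j'; rewrite mxE consrV_lift.
Qed.

Lemma open_rV_bigcup n (U : set 'rV[R]_n) : open U ->
  U = \bigcup_(p in [set p : 'rV[rat]_n * nat |
        ball (map_mx ratr p.1 : 'rV[R]_n) (p.2.+1%:R^-1) `<=` U])
      ball (map_mx ratr p.1 : 'rV[R]_n) (p.2.+1%:R^-1).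
Proof.
move=> oU; apply/seteqP; split => [x Ux|x [p pU /pU]//].
have /nbhs_ballP[e /= e0 xeU] : nbhs x U by exact: open_nbhs_nbhs.
have [k ke] : exists k : nat, k.+1%:R^-1 < e / 2 :> R.
  have e20 : 0 < e / 2 by rewrite divr_gt0.
  have [k _ kP] := near_infty_natSinv_lt (PosNum e20).
  by exists k; exact: (kP k (leqnn k)).
have k0 : 0 < k.+1%:R^-1 :> R by rewrite invr_gt0.
have /choice[q qP] : forall j : 'I_n, exists q : rat, ball (x 0 j) k.+1%:R^-1 (ratr q : R).
  move=> j.
  have [y [yb [q _ qy]]] := @dense_rat R (ball (x 0 j) k.+1%:R^-1)
    (ex_intro _ _ (ballxx _ k0)) (ball_open _ _).
  by exists q; rewrite qy.
have bx : ball x k.+1%:R^-1 (map_mx ratr (\row_j q j) : 'rV[R]_n).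
  by split => // i j; rewrite ord1 !mxE; exact: qP.
exists (\row_j q j, k) => /=; last exact: ball_sym.
move=> y qy; apply: xeU.
have := ball_triangle bx qy; apply: le_ball.
by rewrite [leRHS](splitr e) lerD// ltW.
Qed.

Lemma measurable_consrV n : measurable_fun setT (@consrV R n).
Proof.
apply: (@measurability _ _ _ (borel 'rV[R]_n.+1) setT (@consrV R n) (@open 'rV[R]_n.+1) erefl).
move=> _ [U oU <-].
rewrite setTI (open_rV_bigcup oU) preimage_bigcup.
rewrite bigcup_mkcond; apply: countable_bigcupT_measurable => [|p].
  exact: countableP.
case: ifPn => // _; rewrite preimage_consrV_ball//.
apply: measurableX.
  by exact: measurable_ball.
apply: sub_sigma_algebra; exact: ball_open.
Qed.


Lemma ball0_sigma_finite n (mu : set (borel 'rV[R]_n) -> \bar R) :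
  (forall r : R, 0 < r -> (mu (ball (0%R : 'rV[R]_n) r) < +oo)%E) ->
  sigma_finite setT mu.
Proof.
move=> mub; exists (fun k => ball (0 : 'rV[R]_n) k.+1%:R) => [|k]; last first.
  by split; [apply: sub_sigma_algebra; exact: ball_open|exact: mub].
apply/esym; rewrite -subTset => x _.
exists (Num.truncn `|x : 'rV[R]_n|) => //=.
rewrite -ball_normE/= sub0r normrN; exact: Num.Theory.truncnS_gt.
Qed.

Lemma lebesgue_rV_is_measure n :
  exists mu : {sigma_finite_measure set (borel 'rV[R]_n) -> \bar R},
    @lebesgue_rV R n = mu.
Proof.
suff : exists2 mu : {sigma_finite_measure set (borel 'rV[R]_n) -> \bar R},
    @lebesgue_rV R n = mu &
    forall r : R, 0 < r -> (mu (ball (0%R : 'rV[R]_n) r) < +oo)%E.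
  by move=> [mu ? _]; exists mu.
elim: n => [|n [mu muE mub]].
  exists (dirac ((0 : 'rV[R]_0) : borel 'rV[R]_0)) => // r r0.
  by rewrite /= diracE ltey.
rewrite /= muE.
pose m : {measure set _ -> \bar R} := (@lebesgue_measure R \x mu)%E.
pose nu : {measure set (borel 'rV[R]_n.+1) -> \bar R} :=
  measure_function_pushforward__canonical__measure_function_Measure m (@measurable_consrV n).
have nub (r : R) : 0 < r -> (nu (ball (0%R : 'rV[R]_n.+1) r) < +oo)%E.
  move=> r0; rewrite /nu/= /pushforward (@preimage_consrV_ball n 0 r r0).
  rewrite (_ : \row_j _ = 0); last by apply/rowP => j; rewrite !mxE.
  rewrite product_measure1E//; last 2 first.
  - exact: measurable_ball.
  - by apply: sub_sigma_algebra; exact: ball_open.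
  by rewrite lte_mul_pinfty ?mub// [X in X \is a fin_num](lebesgue_measure_ball _ (ltW r0)).
have nusf : sigma_finite setT nu by exact: ball0_sigma_finite.
pose nus := Measure_isSigmaFinite.Build _ _ _ nu nusf.
pose nu' : {sigma_finite_measure set _ -> \bar R} := HB.pack (Measure.sort nu) (Measure.class nu) nus.
by exists nu'.
Qed.

Let lebesgue_rV0 n : @lebesgue_rV R n set0 = 0%E.
Proof. by have [mu ->] := lebesgue_rV_is_measure n; exact: measure0. Qed.

Let lebesgue_rV_ge0 n A : (0 <= @lebesgue_rV R n A)%E.
Proof. by have [mu ->] := lebesgue_rV_is_measure n; exact: measure_ge0. Qed.

Let lebesgue_rV_sigma_additive n : semi_sigma_additive (@lebesgue_rV R n).
Proof.
have [mu ->] := lebesgue_rV_is_measure n.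
exact: measure_semi_sigma_additive.
Qed.

HB.instance Definition _ n := isMeasure.Build _ _ _ (@lebesgue_rV R n)
  (lebesgue_rV0 n) (@lebesgue_rV_ge0 n) (@lebesgue_rV_sigma_additive n).

Let lebesgue_rV_sigma_finite n : sigma_finite setT (@lebesgue_rV R n).
Proof. by have [mu ->] := lebesgue_rV_is_measure n; exact: sigma_finiteT. Qed.

HB.instance Definition _ n := Measure_isSigmaFinite.Build _ _ _
  (@lebesgue_rV R n) (@lebesgue_rV_sigma_finite n).

End lebesgue_theory.

Section probability.
Context {R : realType}.

Definition prob_support d (PX : probability (borel 'rV[R]_d) R) : set 'rV[R]_d :=
  \bigcap_(F in [set F : set 'rV[R]_d | closed F /\ PX F = 1%E]) F.

Definition standard d (nu : {measure set (borel 'rV[R]_d) -> \bar R})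
    (S : set 'rV[R]_d) : Prop :=
  exists lambda delta : R, [/\ 0 < lambda, 0 < delta &
    forall (x : 'rV[R]_d) (eps : R), S x -> 0 < eps <= lambda ->
      (delta%:E * lebesgue_rV (eball x eps) <= nu (eball x eps `&` S))%E].

Definition mutually_independent d d' (Omega : measurableType d)
    (T : measurableType d') (P : probability Omega R)
    (X : nat -> {RV P >-> T}) : Prop :=
  forall (J : {fset nat}) (A : nat -> set T), (forall i, i \in J -> measurable (A i)) ->
    P (\bigcap_(i in [set` J]) (X i @^-1` A i)) =
    (\prod_(i <- J) P (X i @^-1` A i))%E.

Definition iid d d' (Omega : measurableType d) (T : measurableType d')
    (P : probability Omega R) (X : nat -> {RV P >-> T})
    (PX : probability T R) : Prop :=
  mutually_independent X /\
  forall i A, measurable A -> distribution P (X i) A = PX A.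

Definition bigO_as d (Omega : measurableType d) (P : probability Omega R)
    (Z : nat -> Omega -> \bar R) (a : nat -> R) : Prop :=
  \forall w \ae P, (limn_esup (fun n => `|Z n w| * ((a n)^-1)%:E) < +oo)%E.

End probability.

(** The sample is indexed from 0: [X 0, ..., X n.-1] are the first [n]
    observations. *)
Definition sample {T U : Type} (X : nat -> T -> U) n (w : T) : set U :=
  [set X i w | i in `I_n].

(* Main.v *)
Require Import Defs.
From HB Require Import structures.
From mathcomp Require Import all_boot all_order all_algebra finmap.
From mathcomp Require Import all_classical all_reals all_analysis.
From mathcomp Require Import ring lra.

(** Both hulls contain the sample and, almost surely, are contained in [S], so
    only the distance from points of [S] to the sample matters. Standardness
    gives [c * r ^ d <= PX (ball y r)] for [y] in [S] and small [r], whence a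
    maximal [2r]-separated family in [S] has at most [1 / (c * r ^ d)] points,
    and the probability that some ball of radius [r] around one of them misses
    the first [n] observations is at most
    [expR (- c * r ^ d * n) / (c * r ^ d)]. With [c * r ^ d = 3 * ln n / n]
    this is at most [1 / n ^ 2], and Borel-Cantelli applies. Everything is done
    in the sup norm, which only costs the factor [d]. *)

Set Implicit Arguments.
Unset Strict Implicit.
Unset Printing Implicit Defensive.
Import Order.TTheory GRing.Theory Num.Theory.
Import numFieldNormedType.Exports.
Local Open Scope classical_set_scope.
Local Open Scope ring_scope.

(** * Euclidean norm against sup norm, and Hausdorff distance of nested sets *)

Section euclidean_theory.
Context {R : realType} {d : nat}.
Implicit Types (x u : 'rV[R]_d) (A B S : set 'rV[R]_d).

Lemma dotp_ge0 u : 0 <= dotp u u.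
Proof. by apply: sumr_ge0 => i _; rewrite -expr2 sqr_ge0. Qed.

Lemma enorm_ge0 u : 0 <= enorm u.
Proof. exact: sqrtr_ge0. Qed.

Lemma ler_coord_enorm u i : `|u 0 i| <= enorm u.
Proof.
rewrite -sqrtr_sqr /enorm ler_sqrt ?dotp_ge0// /dotp (bigD1 i)//= -expr2 lerDl.
by apply: sumr_ge0 => j _; rewrite -expr2 sqr_ge0.
Qed.

Lemma ler_coord_norm u i : `|u 0 i| <= `|u|.
Proof.
by rewrite [leRHS]/Num.norm/= mx_normrE (le_bigmax _ (fun ij => `|u ij.1 ij.2|) (0, i)).
Qed.

(** Bounding every coordinate by the sup norm gives the factor [sqrt d], relaxed here to [d] through
    [d <= d ^ 2]. *)
Lemma ler_enorm_norm u : enorm u <= d%:R * `|u|.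
Proof.
have u0 : 0 <= d%:R * `|u| by rewrite mulr_ge0.
rewrite -(ger0_norm u0) -sqrtr_sqr /enorm ler_wsqrtr//.
apply: (@le_trans _ _ (\sum_(i < d) `|u| ^+ 2)).
  apply: ler_sum => i _; rewrite -expr2 -[u 0 i ^+ 2]real_normK ?num_real//.
  by rewrite ler_pXn2r ?nnegrE// ler_coord_norm.
rewrite sumr_const card_ord -[leLHS]mulr_natl exprMn ler_wpM2r// -natrX ler_nat.
by case: (d) => // n; rewrite leq_pmulr.
Qed.

Lemma enorm_continuous : continuous (@enorm R d).
Proof.
move=> u; apply: continuous_comp; last exact: sqrt_continuous.
move: u; apply: continuous_big => [|i _ u]; first exact: add_continuous.
by apply: continuousM; exact: coord_continuous.
Qed.

Lemma eball_open x r : open (eball x r).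
Proof.
rewrite (_ : eball x r = (fun z => enorm (z - x)) @^-1` [set s | s < r])//.
apply: open_comp; last exact: open_lt.
move=> z _; apply: continuous_comp; last exact: enorm_continuous.
by apply: continuousB; [exact: cvg_id|exact: cst_continuous].
Qed.

Lemma eball_sub_ball x r : eball x r `<=` ball x r.
Proof.
move=> z zx; split; first exact: le_lt_trans (enorm_ge0 _) zx.
move=> i j; rewrite ord1 -ball_normE/= distrC.
by rewrite (le_lt_trans _ zx)// (le_trans _ (ler_coord_enorm _ j))// !mxE.
Qed.

Lemma ball_sub_eball x r : (0 < d)%N -> ball x (r / d%:R) `<=` eball x r.
Proof.
move=> d0 z; rewrite -ball_normE/= => xz; apply: (le_lt_trans (ler_enorm_norm _)).
by rewrite mulrC -ltr_pdivlMr ?ltr0n// distrC.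
Qed.

(** An empty supremum is [-oo] in the extended reals; a point of [A] makes the first of the two
    suprema nonnegative. *)
Lemma hausdorff_dist_ge0 A B : A !=set0 -> (0 <= hausdorff_dist A B)%E.
Proof.
move=> [a Aa]; rewrite /hausdorff_dist le_max; apply/orP; left.
apply: (@le_trans _ _ (ereal_inf [set (enorm (a - b))%:E | b in B])).
  by apply: le_ereal_inf_tmp => _ [b _ <-]; rewrite lee_fin enorm_ge0.
by apply: ereal_sup_ubound; exists a.
Qed.

(** Inclusion puts every point of [A] at distance 0 from [B], so only the distances from points of
    [B] to [A] remain to be bounded. *)
Lemma hausdorff_dist_subset A B (r : R) : 0 <= r -> A `<=` B ->
  (forall b, B b -> exists2 a, A a & enorm (a - b) <= r) ->
  (hausdorff_dist A B <= r%:E)%E.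
Proof.
move=> r0 AB Br; rewrite /hausdorff_dist ge_max; apply/andP; split.
  apply: ge_ereal_sup => _ [a Aa <-]; apply: (@le_trans _ _ (enorm (a - a))%:E).
    by apply: ereal_inf_lbound; exists a => //; exact: AB.
  rewrite subrr lee_fin /enorm /dotp big1 ?sqrtr0// => i _.
  by rewrite mxE mul0r.
apply: ge_ereal_sup => _ [b Bb <-]; have [a Aa abr] := Br b Bb.
apply: (@le_trans _ _ (enorm (a - b))%:E); last by rewrite lee_fin.
by apply: ereal_inf_lbound; exists a.
Qed.

End euclidean_theory.

(** A sup-norm ball is a cube: its preimage under [consrV] is an interval times a cube of one
    dimension less, which the product measure evaluates by induction. *)
Lemma lebesgue_rV_ball (R : realType) n (q : 'rV[R]_n) (r : R) : 0 < r ->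
  lebesgue_rV (ball q r) = ((2 * r) ^+ n)%:E.
Proof.
move=> r0; elim: n q => [|n IHn] q.
  rewrite /= diracE mem_set//; split => // i j; by case: j.
have [mu muE] := @lebesgue_rV_is_measure R n.
rewrite /= /pushforward preimage_consrV_ball// muE product_measure1E.
- rewrite -muE IHn [X in (X * _)%E](lebesgue_measure_ball _ (ltW r0)).
  by rewrite -EFinM exprS mulr_natl.
- exact: measurable_realfun.measurable_ball.
- by apply: sub_sigma_algebra; exact: ball_open.
Qed.

(** * The support of a distribution: measurability and full mass *)

Section prob_support_theory.
Context {R : realType} {d : nat} (PX : probability (borel 'rV[R]_d) R).
Implicit Types (F U : set 'rV[R]_d).

Lemma open_borel U : open U -> measurable (U : set (borel 'rV[R]_d)).
Proof. exact: sub_sigma_algebra. Qed.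

Lemma closed_borel F : closed F -> measurable (F : set (borel 'rV[R]_d)).
Proof.
move=> cF; rewrite -[F]setCK; apply: measurableC.
by apply: open_borel; exact: closed_openC.
Qed.

Lemma closed_prob_support : closed (prob_support PX).
Proof. by apply: closed_bigI => F []. Qed.

(** The closed sets being intersected need not be countably many; instead, the complement of the
    support is covered by the null balls with rational centre and radius [1 / k.+1], and these are
    countable. *)
Lemma prob_support_full : PX (prob_support PX) = 1%E.
Proof.
set S := prob_support PX.
have mS : measurable (S : set (borel 'rV[R]_d)) 
  by apply: closed_borel; exact: closed_prob_support.
pose B (p : 'rV[rat]_d * nat) : set (borel 'rV[R]_d) :=
  ball (map_mx ratr p.1 : 'rV[R]_d) (p.2.+1%:R^-1).
(* Enumerates these balls along the naturals, with those of positive mass replaced by the empty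
   set. *)
pose G k : set (borel 'rV[R]_d) :=
  if choice.unpickle k is Some p then if PX (B p) == 0%E then B p else set0 else set0.
have GN k : PX.-negligible (G k).
  rewrite /G; case: (choice.unpickle k) => [p|]; last exact: negligible_set0.
  case: eqP => [p0|_]; last exact: negligible_set0.
  by apply/negligibleP => //; apply: open_borel; exact: ball_open.
have SN : PX.-negligible (~` S).
  apply: negligibleS (negligible_bigcup GN) => x.
  rewrite /S /prob_support setC_bigcap => -[F [cF F1] Fx].
  have mF := closed_borel cF.
  have oF : open (~` F) by exact: closed_openC.
  (* A point outside a closed [F] of mass 1 lies in a rational ball contained in the null complement
     of [F], hence itself null. *)
  move: Fx; rewrite (open_rV_bigcup oF) => -[p /= pF px].
  exists (choice.pickle p) => //; rewrite /G choice.pickleK ifT//.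
  rewrite -measure_le0 (@le_trans _ _ (PX (~` F)))//.
    by rewrite le_measure// inE; [apply: open_borel; exact: ball_open|exact: measurableC].
  by rewrite probability_setC// F1 subee.
have S0 : PX (~` S) = 0%E by apply: measure_negligible => //; exact: measurableC.
by rewrite -[S]setCK probability_setC ?S0 ?sube0//; exact: measurableC.
Qed.

End prob_support_theory.

(** * Borel-Cantelli for events of probability at most [1 / n ^ 2] *)

Lemma borel_cantelli_inv_sq (R : realType) disp (T : measurableType disp)
    (P : probability T R) (E : nat -> set T) :
  (\forall n \near \oo, measurable (E n) /\ (P (E n) <= ((n%:R ^+ 2)^-1)%:E)%E) ->
  {ae P, forall w, \forall n \near \oo, ~ E n w}.
Proof.
(* The shift by [N] makes the hypothesis hold at every index; the extra 2 gives
   [(n + 1) * (n + 2) <= (n + N + 2) ^ 2]. *)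
move=> [N _ EN]; pose F n := E (n + N.+2)%N.
have {}EN n : measurable (F n) /\ (P (F n) <= (((n + N.+2)%:R ^+ 2)^-1)%:E)%E.
  by apply: EN => /=; rewrite !addnS !leqW// leq_addl.
have mF n : measurable (F n) by case: (EN n).
(* The increments of [u] are [1 / ((n + 1) * (n + 2))], so the series of probabilities is dominated
   by a telescoping sum bounded by 1. *)
pose u n : R := - (n.+1%:R)^-1.
have Fu n : (P (F n) <= (u n.+1 - u n)%:E)%E.
  have [_ /le_trans] := EN n; apply; rewrite lee_fin /u.
  have n1 : n.+1%:R != 0 :> R by rewrite pnatr_eq0.
  have n2 : n.+2%:R != 0 :> R by rewrite pnatr_eq0.
  have -> : - n.+2%:R^-1 - - n.+1%:R^-1 = (n.+1%:R * n.+2%:R)^-1 :> R.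
    rewrite -[n.+2%:R]natr1 in n2 *; move: (n.+1%:R) n1 n2 => a a0 a1.
    by field; rewrite a0 a1.
  rewrite lef_pV2 ?posrE ?mulr_gt0 ?exprn_gt0 ?ltr0n ?addnS//.
  by rewrite expr2 ler_pM ?ler_nat ?ler0n// !ltnS ?leqW// leq_addr.
have Plim : P (lim_sup_set F) = 0%E.
  apply: lim_sup_set_cvg0 => //; apply: (@le_lt_trans _ _ 1%E); last exact: ltey.
  apply: lime_le; first by apply: is_cvg_nneseries.
  apply: nearW => n; apply: (@le_trans _ _ (\sum_(0 <= k < n) (u k.+1 - u k)%:E)%E).
    by apply: lee_sum => k _; exact: Fu.
  rewrite sumEFin telescope_sumr// lee_fin /u opprK invr1 gerDr.
  by rewrite oppr_le0 invr_ge0.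
exists (lim_sup_set F); split => //.
  by apply: bigcapT_measurable => n; apply: bigcup_measurable.
move=> w; apply: contra_notP => /existsNP[n Fn].
exists (n + N.+2)%N => // m /= nm Em; apply: Fn => _.
exists (m - N.+2)%N => /=; first by rewrite leq_subRL 1?addnC// (leq_trans _ nm)// leq_addl.
by rewrite /F subnK// (leq_trans _ nm)// leq_addl.
Qed.

(** * Packing: separated families are small, and maximal ones are nets *)

Section packing.
Context {R : realType} {d : nat} (PX : probability (borel 'rV[R]_d) R).
Implicit Types (S : set 'rV[R]_d) (s : seq 'rV[R]_d).

Let measurable_ball (y : 'rV[R]_d) r : measurable (ball y r : set (borel 'rV[R]_d)).
Proof. by apply: open_borel; exact: ball_open. Qed.

(** Balls of radius [r] around [2 * r]-separated centres are disjoint, so their masses add up to at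
    most 1. *)
Lemma separated_size_le s (r c : R) :
  pairwise (fun x y => 2 * r <= `|x - y|) s ->
  (forall y, y \in s -> (c%:E <= PX (ball y r))%E) ->
  (size s)%:R * c <= 1.
Proof.
pose B y : set (borel 'rV[R]_d) := ball y r.
have mB s' : measurable (\big[setU/set0]_(y <- s') B y).
  by apply: bigsetU_measurable => y _; exact: measurable_ball.
move=> sep cP; rewrite -lee_fin.
apply: (@le_trans _ _ (PX (\big[setU/set0]_(y <- s) B y))); last first.
  exact: probability_le1.
elim: s sep cP => [|y s IHs] /=; first by rewrite big_nil measure0 mul0r.
move=> /andP[ys sep] cP; rewrite big_cons measureU//; last 2 first.
- exact: measurable_ball.
- apply/seteqP; split => // z; rewrite -bigcup_seq => -[yz [x /= xs xz]].
  move: yz xz (allP ys _ xs); rewrite /B -!ball_normE/= (distrC x) => yz xz.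
  rewrite leNgt => /negP; apply.
  by rewrite (le_lt_trans (ler_distD z _ _))// mulr_natl mulr2n ltrD.
rewrite -natr1 mulrDl mul1r EFinD addrC leeD//.
  by apply: cP; rewrite mem_head.
by apply: IHs => // x xs; apply: cP; rewrite in_cons xs orbT.
Qed.

(** Separated families in [S] have bounded size, so a largest one exists; a point of [S] at distance
    at least [2 * r] from all its members could be added to it. *)
Lemma exists_net S (r c : R) : 0 < c ->
  (forall y, S y -> (c%:E <= PX (ball y r))%E) ->
  exists s, [/\ forall y, y \in s -> S y, (size s)%:R <= c^-1 &
    forall x, S x -> exists2 y, y \in s & `|x - y| < 2 * r].
Proof.
move=> c0 cP.
pose sep s := (forall y, y \in s -> S y) /\
  pairwise (fun x y => 2 * r <= `|x - y|) s.
have sepc s : sep s -> (size s)%:R <= c^-1.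
  move=> [sS sP]; rewrite -[leRHS]mul1r ler_pdivlMr//.
  by apply: separated_size_le sP _ => y /sS; exact: cP.
have ex : exists k, `[< exists2 s, sep s & size s = k >].
  by exists 0%N; apply/asboolP; exists [::] => //; split.
have ub k : `[< exists2 s, sep s & size s = k >] -> (k <= Num.bound c^-1)%N.
  move=> /asboolP[s ss <-]; rewrite -(ler_nat R) (le_trans (sepc _ ss))// ltW//.
  by rewrite archi_boundP// invr_ge0 ltW.
have [_ /asboolP[s ss <-] smax] := ex_maxnP ex ub.
exists s; split; [by case: ss|exact: sepc|move=> x Sx; apply/not_exists2P => xs].
have : (size (x :: s) <= size s)%N.
  apply: smax; apply/asboolP; exists (x :: s) => //; case: ss => sS sP; split.
    by move=> y; rewrite in_cons => /predU1P[->//|/sS].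
  rewrite /= sP andbT; apply/allP => y ys; rewrite leNgt; apply/negP => xy.
  by case: (xs y).
by rewrite ltnn.
Qed.

End packing.

(** * Probability that the sample leaves part of the support uncovered *)

Section sampling.
Context {R : realType} {d : nat} {disp : measure_display}
  {Omega : measurableType disp} (P : probability Omega R)
  (PX : probability (borel 'rV[R]_d) R)
  (X : nat -> {RV P >-> borel 'rV[R]_d}).
Hypothesis X_iid : iid X PX.

Definition miss n (B : set (borel 'rV[R]_d)) : set Omega :=
  \bigcap_(j in `I_n) X j @^-1` ~` B.

Lemma measurable_miss n B : measurable B -> measurable (miss n B).
Proof.
move=> mB; rewrite /miss bigcap_mkord; apply: bigsetI_measurable => j _.
by rewrite -[X in measurable X]setTI; apply: measurable_funP => //; exact: measurableC.
Qed.

Lemma prob_miss n B : measurable B -> P (miss n B) = ((fine (PX (~` B))) ^+ n)%:E.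
Proof.
move=> mB; have mBC := measurableC mB.
have [ind dist] := X_iid.
pose J := [fset i in iota 0 n]%fset.
have -> : miss n B = \bigcap_(i in [set` J]) X i @^-1` (~` B).
  rewrite /miss (_ : `I_n = [set` J])//.
  by apply/seteqP; split => i; rewrite /= !inE mem_iota.
rewrite (ind J (fun=> ~` B))// (eq_bigr (fun=> (fine (PX (~` B)))%:E)); last first.
  by move=> i _; rewrite fineK ?fin_num_measure// -(dist i).
by rewrite prodEFin big_const_seq count_predT card_fseq undup_id ?iota_uniq//
  size_iota iter_mulr_1.
Qed.

(** By independence the probability is at most [(1 - c) ^ n], and [1 - c <= expR (- c)]. *)
Lemma prob_miss_le n B (c : R) : measurable B -> (c%:E <= PX B)%E ->
  (P (miss n B) <= (expR (- (c * n%:R)))%:E)%E.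
Proof.
move=> mB cB; rewrite prob_miss// lee_fin mulrC -mulrN expRM_natl.
rewrite lerXn2r ?nnegrE ?expR_ge0 ?fine_ge0//.
rewrite (le_trans _ (expR_ge1Dx _))// -lee_fin fineK; last first.
  by rewrite fin_num_measure//; exact: measurableC.
by rewrite probability_setC// EFinD EFinN leeD2l// leeN2.
Qed.

(** [E] is a finite union over a net, hence measurable, and the union bound applies. Off [E], a
    point of [S] is within [2 * r] of a net point, itself within [r] of an observation, whence
    [3 * r]. *)
Lemma coverage (S : set 'rV[R]_d) n (r c : R) : 0 < c ->
  (forall y, S y -> (c%:E <= PX (ball y r))%E) ->
  exists E, [/\ measurable E, (P E <= (c^-1 * expR (- (c * n%:R)))%:E)%E &
    forall w, ~ E w -> forall x, S x -> exists2 j, (j < n)%N & `|X j w - x| < 3 * r].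
Proof.
move=> c0 cP; have [s [sS sc snet]] := exists_net c0 cP.
have mB y : measurable (ball y r : set (borel 'rV[R]_d)).
  by apply: open_borel; exact: ball_open.
exists (\big[setU/set0]_(y <- s) miss n (ball y r)); split.
- by apply: bigsetU_measurable => y _; exact: measurable_miss.
- apply: (@le_trans _ _ ((size s)%:R * expR (- (c * n%:R)))%:E); last first.
    by rewrite lee_fin ler_wpM2r// expR_ge0.
  elim: s sS {sc snet} => [|y s IHs] sS; first by rewrite big_nil measure0 mul0r.
  have ms : measurable (\big[setU/set0]_(y <- s) miss n (ball y r)).
    by apply: bigsetU_measurable => x _; exact: measurable_miss.
  rewrite big_cons /= -natr1 mulrDl mul1r addrC EFinD.
  apply: (le_trans (measureU2 _ _ _)) => //; first exact: measurable_miss.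
  apply: leeD; first by apply: prob_miss_le => //; apply/cP/sS; rewrite mem_head.
  by apply: IHs => x xs; apply: sS; rewrite in_cons xs orbT.
move=> w Ew x /snet[y ys xy].
apply/not_exists2P => Xx; apply: Ew; rewrite -bigcup_seq; exists y => //= j /= jn.
move=> yX; case: (Xx j) => //; apply; move: yX; rewrite -ball_normE/= => yX.
rewrite (le_lt_trans (ler_distD y _ _))//.
by rewrite distrC in yX; rewrite distrC in xy; lra.
Qed.

End sampling.

(** * From the coverage estimate to an almost sure rate *)

Lemma ln_div_nat_le (R : realType) (t : R) : 0 < t ->
  \forall n \near \oo, ln n%:R / n%:R <= t.
Proof.
move=> t0; near=> n.
have n0 : 0 < n%:R :> R by rewrite ltr0n; near: n; exact: nbhs_infty_gt.
have s0 : 0 < Num.sqrt n%:R :> R by rewrite sqrtr_gt0.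
(* Since [ln n = 2 * ln (sqrt n) <= 2 * sqrt n], the quotient is at most [2 / sqrt n]. *)
have ts : 2 / t <= Num.sqrt n%:R.
  have t2 : 0 <= 2 / t by rewrite divr_ge0// ltW.
  rewrite -(ger0_norm t2) -sqrtr_sqr ler_wsqrtr//.
  by near: n; exact: nbhs_infty_ger.
rewrite ler_pdivrMr// -{2}(sqr_sqrtr (ltW n0)) -{1}(sqr_sqrtr (ltW n0)) lnXn//.
have := ln_sublinear s0; rewrite ler_pdivrMr// in ts.
move: (Num.sqrt _) s0 ts => s s0 ts /ltW lns.
rewrite -[_ *+ 2]mulr_natl (le_trans (ler_wpM2l _ lns))//.
by rewrite expr2 mulrA ler_pM2r// mulrC.
Unshelve. all: by end_near. Qed.

Lemma standard_ball (R : realType) d (PX : probability (borel 'rV[R]_d) R)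
    (S : set 'rV[R]_d) : (0 < d)%N -> closed S -> standard PX S ->
  exists c lambda : R, [/\ 0 < c, 0 < lambda & forall y r, S y -> 0 < r <= lambda ->
    ((c * r ^+ d)%:E <= PX (ball y r))%E].
Proof.
move=> d0 cS [lambda [delta [l0 dl0 std]]].
have d0R : 0 < d%:R :> R by rewrite ltr0n.
(* The Euclidean ball of radius [r] contains the cube of half-side [r / d], of volume
   [(2 * r / d) ^ d]. *)
exists (delta * (2 / d%:R) ^+ d), lambda; split => //.
  by rewrite mulr_gt0// exprn_gt0// divr_gt0.
move=> y r Sy /[dup] /andP[r0 _] /(std y r Sy).
have mB z e : measurable (ball z e : set (borel 'rV[R]_d)).
  by apply: open_borel; exact: ball_open.
have mE : measurable (eball y r : set (borel 'rV[R]_d)).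
  by apply: open_borel; exact: eball_open.
have rd0 : 0 < r / d%:R by rewrite divr_gt0.
move=> H; apply: (@le_trans _ _ (delta%:E * lebesgue_rV (eball y r))%E).
  rewrite -mulrA -exprMn mulrAC -mulrA EFinM lee_pmul2l ?lte_fin// -(lebesgue_rV_ball y rd0).
  by rewrite le_measure ?inE//; exact: ball_sub_eball.
rewrite (le_trans H)// le_measure ?inE//.
  by apply: measurableI => //; exact: closed_borel.
by move=> z [/eball_sub_ball].
Qed.

Lemma bigO_as_near (R : realType) disp (Omega : measurableType disp)
    (P : probability Omega R) (Z : nat -> Omega -> \bar R) (a : nat -> R) (C : R) :
  (\forall n \near \oo, 0 < a n) ->
  {ae P, forall w, \forall n \near \oo, (0 <= Z n w <= (C * a n)%:E)%E} ->
  bigO_as P Z a.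
Proof.
move=> a0; apply: filterS => w ZC.
apply: (@le_lt_trans _ _ C%:E); last exact: ltey.
rewrite /limn_esup limf_esupE; apply: ge_ereal_inf.
(* The limsup is an infimum of suprema over sets in the filter at infinity; the indices satisfying
   the bound form such a set, on which the supremum is at most [C]. *)
exists (ereal_sup [set (`|Z n w| * ((a n)^-1)%:E)%E |
    n in [set n | 0 < a n /\ (0 <= Z n w <= (C * a n)%:E)%E]]).
  by eexists; [exact: filterI a0 ZC|].
apply: ge_ereal_sup => _ [n [an0 /andP[Z0 ZCn]] <-].
by rewrite gee0_abs// lee_pdivrMr// -EFinM.
Qed.

Lemma sample_in_support (R : realType) d disp (Omega : measurableType disp)
    (P : probability Omega R) (PX : probability (borel 'rV[R]_d) R)
    (X : nat -> {RV P >-> borel 'rV[R]_d}) : iid X PX ->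
  {ae P, forall w, forall i, prob_support PX (X i w)}.
Proof.
move=> [_ dist]; apply/ae_foralln => i.
have mS : measurable (prob_support PX : set (borel 'rV[R]_d)).
  by apply: closed_borel; exact: closed_prob_support.
exists (X i @^-1` ~` prob_support PX); split => //.
  by rewrite -[X in measurable X]setTI; apply: measurable_funP => //; exact: measurableC.
transitivity (PX (~` prob_support PX)); first by apply: (dist i); exact: measurableC.
by rewrite probability_setC// prob_support_full subee.
Qed.

Lemma sample_rate (R : realType) d disp (Omega : measurableType disp)
    (P : probability Omega R) (PX : probability (borel 'rV[R]_d) R)
    (X : nat -> {RV P >-> borel 'rV[R]_d}) (S : set 'rV[R]_d) :
  (0 < d)%N -> closed S -> standard PX S -> iid X PX ->
  exists2 C : R, 0 <= C & {ae P, forall w, \forall n \near \oo,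
    forall x, S x -> exists2 j, (j < n)%N &
      enorm (X j w - x) <= C * (ln n%:R / n%:R) `^ (d%:R^-1)}.
Proof.
move=> d0 cS std Xiid.
have d0R : 0 < d%:R :> R by rewrite ltr0n.
have [c [l [c0 l0 cl]]] := standard_ball d0 cS std.
(* Solves [c * r ^ d = 3 * ln n / n]. The factor 3 makes the exponential [n ^- 3], and the size of
   the net costs one power of [n]. *)
pose r n := (3 / c * (ln n%:R / n%:R)) `^ (d%:R^-1) : R.
have rE n : (1 < n)%N -> c * r n ^+ d = 3 * ln n%:R / n%:R.
  move=> n1; rewrite -powR_mulrn ?powR_ge0// -powRrM mulVf ?gt_eqF// powRr1.
    by rewrite mulrA [c * _]mulrC divfK ?gt_eqF// mulrA.
  by rewrite !mulr_ge0 ?invr_ge0 ?(ltW c0)// ln_ge0// ler1n ltnW.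
pose event n E := [/\ measurable E, (P E <= ((n%:R ^+ 2)^-1)%:E)%E &
  forall w, ~ E w -> forall x, S x -> exists2 j, (j < n)%N & `|X j w - x| < 3 * r n].
have : \forall n \near \oo, exists E, event n E.
  near=> n.
  have n1 : (1 < n)%N by near: n; exact: nbhs_infty_gt.
  have n0 : 0 < n%:R :> R by rewrite ltr0n ltnW.
  (* From [ln (1 / n) <= 1 / n - 1] and [n >= 2]; it yields [1 <= 3 * ln n], which absorbs the
     remaining factor in the final comparison with [1 / n ^ 2]. *)
  have ln0 : 2^-1 <= ln n%:R :> R.
    have := @le_ln1Dx R (n%:R^-1 - 1); rewrite addrCA subrr addr0 lnV ?posrE// ltrBrDr addNr.
    rewrite invr_gt0 => /(_ n0).
    have : n%:R^-1 <= 2^-1 :> R by rewrite lef_pV2 ?posrE// ler_nat.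
    by lra.
  have lnp : 0 < ln n%:R :> R by apply: lt_le_trans ln0; rewrite invr_gt0.
  have ni0 : 0 < n%:R^-1 :> R by rewrite invr_gt0.
  pose q : R := 3 * ln n%:R / n%:R.
  have q0 : 0 < q by rewrite !mulr_gt0 ?invr_gt0.
  have r0 : 0 < r n.
    by rewrite powR_gt0// !mulr_gt0 ?invr_gt0.
  have rl : r n <= l.
    have dl : l = (l ^+ d) `^ (d%:R^-1).
      by rewrite -powR_mulrn ?(ltW l0)// -powRrM mulfV ?gt_eqF// powRr1// ltW.
    rewrite dl ge0_ler_powR ?nnegrE ?invr_ge0 ?exprn_ge0 ?(ltW l0)//.
      by rewrite !mulr_ge0 ?invr_ge0// ltW.
    rewrite mulrC -ler_pdivlMr ?divr_gt0//.
    near: n; apply: ln_div_nat_le.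
    by rewrite divr_gt0// ?exprn_gt0// divr_gt0.
  have qP y : S y -> (q%:E <= PX (ball y (r n)))%E.
    by move=> Sy; rewrite /q -rE//; apply: cl => //; rewrite r0.
  have [E [mE PE Ecov]] := coverage Xiid n q0 qP.
  exists E; split => //; apply: (le_trans PE); rewrite lee_fin.
  have -> : q * n%:R = ln (n%:R ^+ 3).
    by rewrite /q divfK ?gt_eqF// lnXn// mulr_natl.
  rewrite expRN lnK ?posrE ?exprn_gt0// -invfM lef_pV2 ?posrE ?mulr_gt0 ?exprn_gt0//.
  rewrite exprS mulrA ler_peMl ?exprn_ge0 ?(ltW n0)// /q divfK ?gt_eqF//.
  by lra.
move=> H.
(* Chooses one event for each [n]; the default [set0] is taken only where none exists, hence for
   finitely many [n]. *)
pose E n := xget set0 (event n).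
have EP : \forall n \near \oo, event n (E n).
  by apply: filterS H => n [F Fn]; exact: (xgetI _ Fn).
have Ecover : {ae P, forall w, \forall n \near \oo, ~ E n w}.
  by apply: borel_cantelli_inv_sq; apply: filterS EP => n [].
(* [d] comes from the norm comparison, 3 from [coverage], and the power of [3 / c] from the radius
   [r n]. *)
exists (d%:R * (3 * (3 / c) `^ (d%:R^-1))).
  by rewrite !mulr_ge0// powR_ge0.
apply: filterS Ecover => w Ew.
near=> n => x Sx.
have [_ _ /(_ w)] : event n (E n) by near: n.
have Enw : ~ E n w by near: n.
move=> /(_ Enw x Sx)[j jn jx]; exists j => //.
have n1 : (1 < n)%N by near: n; exact: nbhs_infty_gt.
rewrite (le_trans (ler_enorm_norm _))// -mulrA ler_wpM2l// (le_trans (ltW jx))//.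
have x0 : 0 <= ln n%:R / n%:R :> R by rewrite divr_ge0// ln_ge0// ler1n ltnW.
have c30 : 0 <= 3 / c by rewrite divr_ge0// ltW.
by rewrite /r (powRM _ c30 x0) mulrA.
Unshelve. all: by end_near. Qed.

(** * The two hulls lie between the sample and the support *)

Lemma sub_cone_hull (R : realType) d (rho h : R) (A : set 'rV[R]_d) :
  A `<=` cone_hull rho h A.
Proof. by move=> x Ax B [_ AB]; exact: AB. Qed.

Lemma cone_hull_sub (R : realType) d (rho h : R) (A S : set 'rV[R]_d) :
  cone_convex rho h S -> A `<=` S -> cone_hull rho h A `<=` S.
Proof. by move=> cS AS x; apply; split. Qed.

Lemma sub_cone_hull_compl (R : realType) d (rho h : R) (A : set 'rV[R]_d) :
  A `<=` cone_hull_compl rho h A.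
Proof.
move=> x Ax p [_ pA] px.
by have : set0 x by rewrite -pA.
Qed.

(** A cone disjoint from [S] is also disjoint from [A], so the hull is monotone, and [S] is its own
    hull. *)
Lemma cone_hull_compl_sub (R : realType) d (rho h : R) (A S : set 'rV[R]_d) :
  cone_convex_compl rho h S -> A `<=` S -> cone_hull_compl rho h A `<=` S.
Proof.
move=> [_ _ SE] AS x Ax; rewrite SE => p [p1 pS]; apply: Ax; split => //.
by apply/seteqP; split => // z [pz /AS Sz]; rewrite -pS.
Qed.

(** Treats both hulls at once: the geometry of cones enters only through the two inclusions assumed
    of [hull]. *)
Lemma hull_rate (R : realType) d disp (Omega : measurableType disp)
    (P : probability Omega R) (PX : probability (borel 'rV[R]_d) R)
    (X : nat -> {RV P >-> borel 'rV[R]_d})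
    (hull : set 'rV[R]_d -> set 'rV[R]_d) :
  (0 < d)%N -> standard PX (prob_support PX) -> iid X PX ->
  (forall A, A `<=` hull A) ->
  (forall A, A `<=` prob_support PX -> hull A `<=` prob_support PX) ->
  bigO_as P (fun n w => hausdorff_dist (hull (sample X n w)) (prob_support PX))
    (fun n => (ln n%:R / n%:R) `^ (d%:R^-1)).
Proof.
move=> d0 std Xiid hullW hullS.
have [C C0 rate] := sample_rate d0 (@closed_prob_support _ _ PX) std Xiid.
apply: (@bigO_as_near _ _ _ _ _ _ C).
  near=> n; apply: powR_gt0.
  (* At [n = 1] the logarithm, and with it the rate, vanishes. *)
  have n1 : (1 < n)%N by near: n; exact: nbhs_infty_gt.
  by rewrite divr_gt0 ?ln_gt0 ?ltr1n// ltr0n ltnW.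
apply: filterS2 (sample_in_support Xiid) rate => w XS Xrate.
near=> n; have n0 : (0 < n)%N by near: n; exact: nbhs_infty_gt.
apply/andP; split.
  by apply: hausdorff_dist_ge0; exists (X 0%N w); apply: hullW; exists 0%N.
apply: hausdorff_dist_subset; first by rewrite mulr_ge0// powR_ge0.
  by apply: hullS => _ [i _ <-].
have : forall x, prob_support PX x -> exists2 j, (j < n)%N &
    enorm (X j w - x) <= C * (ln n%:R / n%:R) `^ (d%:R^-1) by near: n.
move=> Xn x /Xn[j jn jx]; exists (X j w) => //.
by apply: hullW; exists j.
Unshelve. all: by end_near. Qed.

Theorem theorem5 (R : realType) (d : nat) (rho h : R)
  (disp : measure_display) (Omega : measurableType disp)
  (P : probability Omega R)
  (PX : probability (borel 'rV[R]_d) R)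
  (X : nat -> {RV P >-> borel 'rV[R]_d})
  (S : set 'rV[R]_d) :
  (0 < d)%N -> 0 < rho <= pi -> 0 < h ->
  iid X PX ->
  S = prob_support PX ->
  compact S ->
  standard PX S ->
  (cone_convex rho h S ->
     bigO_as P
       (fun n w => hausdorff_dist (cone_hull rho h (sample X n w)) S)
       (fun n => (ln n%:R / n%:R) `^ (d%:R^-1))) /\
  (cone_convex_compl rho h S ->
     bigO_as P
       (fun n w => hausdorff_dist (cone_hull_compl rho h (sample X n w)) S)
       (fun n => (ln n%:R / n%:R) `^ (d%:R^-1))).
Proof.
move=> d0 _ _ Xiid -> _ std; split => cS; apply: hull_rate => // A.
- exact: sub_cone_hull.
- exact: cone_hull_sub.
- exact: sub_cone_hull_compl.
- exact: cone_hull_compl_sub.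
Qed.
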